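(* If $G$ is an arborescence on $n$ vertices with clique number $k$, then $\ell(G)=2n-k$.
   Context: A treelike comparability graph is a graph admitting a transitive orientation whose Hasse diagram (transitive reduction), as an undirected graph, is a tree. A double-arborescence is a treelike comparability graph $G=(V,E)$ with a vertex $r$ such that $V=\{r\}\cup N_G(r)$; it is an arborescence if, under the treelike orientation, such a root is a source or a sink. A word over a finite alphabet is a finite sequence of letters. Letters $a,b$ alternate in a word $w$ if the subsequence of $w$ consisting of all occurrences of $a$ and $b$ is of the form $abab\cdots$ or $baba\cdots$ (of even or odd length). A graph $G=(V,E)$ is word-representable if there is a word $w$ over $V$ (a word-representant) such that for all $a,b\in V$, $a$ and $b$ are adjacent iff they alternate in $w$. $\ell(G)$ denotes the minimum length of a word-representant of $G$. The clique number is the size of a largest complete subgraph. *)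

(* Defs.v *)
From mathcomp Require Import all_boot.

Set Implicit Arguments.
Unset Strict Implicit.
Unset Printing Implicit Defensive.

(* Plain MathComp.  A finite simple graph is a symmetric irreflexive adjacency
   relation [e : rel T] on a finType of vertices. *)

Section Defs.

Variable T : finType.
Implicit Types (e o h : rel T) (w : seq T) (a b r : T) (A : {set T}).

Definition simple_graph e : Prop := symmetric e /\ irreflexive e.

(* Only meant for simple [h]: a [ucycle] of size at most 2 is a vertex or an
   edge walked back and forth, not a graph cycle. *)
Definition is_tree h : Prop :=
  [/\ 0 < #|T|, forall x y, connect h x y
    & forall c : seq T, ucycle h c -> size c <= 2].

(* [o x y] is the arc from x to y. *)
Definition is_orientation e o : Prop :=
  (forall x y, e x y = o x y || o y x) /\
  (forall x y, ~~ (o x y && o y x)).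

Definition transitive_orientation e o : Prop :=
  is_orientation e o /\ transitive o.

Definition hasse o : rel T :=
  fun x y => o x y && ~~ [exists z, o x z && o z y].

Definition hasse_graph o : rel T := fun x y => hasse o x y || hasse o y x.

Definition treelike_orientation e o : Prop :=
  transitive_orientation e o /\ is_tree (hasse_graph o).

Definition treelike_comparability_graph e : Prop :=
  exists o, treelike_orientation e o.

Definition is_root e r : Prop := forall v, v = r \/ e r v.

Definition double_arborescence e : Prop :=
  treelike_comparability_graph e /\ exists r, is_root e r.

Definition is_source o r : Prop := forall v, ~~ o v r.
Definition is_sink o r : Prop := forall v, ~~ o r v.

Definition arborescence e : Prop :=
  double_arborescence e /\
  exists o r, [/\ treelike_orientation e o, is_root e r
                & is_source o r \/ is_sink o r].

(* The word abab... of length n. *)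
Definition alt_word a b (n : nat) : seq T :=
  mkseq (fun i => if odd i then b else a) n.

Definition alternate w a b : Prop :=
  let u := [seq x <- w | (x == a) || (x == b)] in
  exists n, u = alt_word a b n \/ u = alt_word b a n.

(* Every vertex must occur in a word-representant: otherwise the empty word
   would represent every complete graph. *)
Definition word_representant e w : Prop :=
  (forall a, a \in w) /\
  (forall a b, a != b -> (e a b <-> alternate w a b)).

(* [is_ell e l]: the graph is word-representable and the minimum length of a
   word-representant is l. *)
Definition is_ell e (l : nat) : Prop :=
  (exists2 w, word_representant e w & size w = l) /\
  (forall w, word_representant e w -> l <= size w).

Definition is_clique e A : bool :=
  [forall x in A, forall y in A, (x != y) ==> e x y].

Definition clique_number e : nat := \max_(A : {set T} | is_clique e A) #|A|.

End Defs.

(* Main.v *)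
(** Letters occurring once in a word-representant alternate pairwise, hence form
    a clique; this gives [2n - k] as a lower bound.

    Conversely, orient the arborescence away from its root, so that the
    predecessors of a vertex form a chain, and let [C] be a maximum clique: a
    chain closed under predecessors.  Depth-first search yields two linear
    extensions [P] and [Q] that order incomparable vertices oppositely, so that
    [P ++ Q] represents the graph.  If the search visits [C] first in [P] and
    last in [Q], a vertex [x] outside [C] precedes in [Q] exactly those [c] in
    [C] that are not below it, and the occurrences of [C] in [P] can be
    erased. *)
Require Import Defs.
From mathcomp Require Import all_boot.

Set Implicit Arguments.
Unset Strict Implicit.
Unset Printing Implicit Defensive.

(** * Restriction of a word to two letters *)

Section Restriction.
Variable T : eqType.
Implicit Types (s w : seq T) (x y : T).

Definition restr x y s := [seq z <- s | (z == x) || (z == y)].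

Lemma restrC x y s : restr x y s = restr y x s.
Proof. by apply: eq_filter => z; rewrite orbC. Qed.

Lemma restr_cat x y s t : restr x y (s ++ t) = restr x y s ++ restr x y t.
Proof. exact: filter_cat. Qed.

Lemma restr_notin2 x y s : x \notin s -> y \notin s -> restr x y s = [::].
Proof.
move=> xs ys; apply/eqP; rewrite -[_ == _]negbK -has_filter.
apply/hasPn => z zs; apply/norP.
by split; [apply: contraNneq xs => <- | apply: contraNneq ys => <-].
Qed.

Lemma restr_notin x y s :
  uniq s -> x \in s -> y \notin s -> restr x y s = [:: x].
Proof.
move=> us xs ys; rewrite -(filter_pred1_uniq us xs).
apply: eq_in_filter => z zs /=.
by rewrite [z == y](negbTE _) ?orbF //; apply: contraNneq ys => <-.
Qed.

(** Only the case with both letters in [B] depends on the order of [s]; the conditional form lets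
    the others be computed by rewriting memberships. *)
Lemma restr_mem (B : {pred T}) s x y : uniq s -> s =i B ->
  restr x y s = if x \in B then if y \in B then restr x y s else [:: x]
                else if y \in B then [:: y] else [::].
Proof.
move=> us sB; rewrite -!sB.
case: ifPn => xs; case: ifPn => ys //; first exact: restr_notin.
  by rewrite restrC restr_notin.
exact: restr_notin2.
Qed.

Lemma restr_in2 x y s : x != y -> count_mem x s = 1 -> count_mem y s = 1 ->
  restr x y s = [:: x; y] \/ restr x y s = [:: y; x].
Proof.
move=> nxy cx cy.
have: perm_eq (restr x y s) [:: x; y].
  apply/allP => z _ /=; rewrite count_filter; apply/eqP => /=.
  have [<-|nxz] := eqVneq x z.
    rewrite [y == x]eq_sym (negbTE nxy) -[RHS]/1 -cx; apply: eq_count => t /=.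
    by case: (t == x).
  have [<-|nyz] := eqVneq y z.
    by rewrite -[RHS]/1 -cy; apply: eq_count => t /=; case: (t == y); rewrite // orbT.
  rewrite -(count_pred0 s); apply: eq_count => t /=.
  by case: eqP => // ->; rewrite ![z == _]eq_sym (negbTE nxz) (negbTE nyz).
move=> H; case: (restr x y s) (perm_size H) (H) => [|a [|b []]] //= _ {}H.
move: (perm_uniq H) (perm_mem H a) (perm_mem H b).
rewrite /= !inE nxy !eqxx !orbT /= andbT => nab.
move=> /esym/orP[]/eqP Ea /esym/orP[]/eqP Eb; rewrite Ea Eb; auto;
  by rewrite Ea Eb eqxx in nab.
Qed.

End Restriction.

Section Alternation.
Variable T : finType.
Implicit Types (w : seq T) (a b : T).

Lemma alternateC w a b : alternate w a b <-> alternate w b a.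
Proof.
rewrite /alternate -!/(restr _ _ _) restrC.
by split=> -[n []]; exists n; auto.
Qed.

Lemma alternate_restr w a b u : restr a b w = u ->
  alternate w a b <-> exists n, u = alt_word a b n \/ u = alt_word b a n.
Proof. by move=> <-. Qed.

(** Consecutive positions of [alt_word] have opposite parity, hence carry different letters. *)
Lemma not_alternate w a b u1 u2 c : a != b -> restr a b w = u1 ++ c :: c :: u2 ->
  ~ alternate w a b.
Proof.
move=> nab E.
have aux x y n : x != y -> u1 ++ c :: c :: u2 <> alt_word x y n.
  move=> nxy Eu; have sz: (size u1).+1 < n.
    by move: (congr1 size Eu); rewrite size_mkseq size_cat /= => <-;
       rewrite !addnS !ltnS leq_addr.
  have:= congr1 (nth c ^~ (size u1)) Eu.
  have:= congr1 (nth c ^~ (size u1).+1) Eu.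
  rewrite /= !nth_mkseq ?(ltnW sz) // !nth_cat ltnn ltnNge leqnSn /= subnn subSnn /=.
  by case: (odd _) => /= -> H; move: nxy; rewrite H eqxx.
by case/(alternate_restr E) => n [] /aux; apply=> //; rewrite eq_sym.
Qed.

End Alternation.

(** * The lower bound *)

Section LowerBound.
Variables (T : finType) (e : rel T).

Lemma size_sum_count (w : seq T) : size w = \sum_(a : T) count_mem a w.
Proof.
elim: w => [|b w IH] /=; first by rewrite big1.
rewrite big_split /= -IH (bigD1 b) //= eqxx big1 // => a.
by rewrite eq_sym => /negbTE->.
Qed.

Lemma word_representant_size w :
  word_representant e w -> 2 * #|T| - clique_number e <= size w.
Proof.
case=> mw rw; pose S := [set a | count_mem a w == 1].
have cS: is_clique e S.
  apply/forallP=> a; apply/implyP; rewrite inE => /eqP ca.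
  apply/forallP=> b; apply/implyP; rewrite inE => /eqP cb.
  apply/implyP=> nab; apply/(rw a b nab).
  by case: (restr_in2 nab ca cb) => E; apply/(alternate_restr E); exists 2; auto.
have leS: #|S| <= clique_number e :=
  @leq_bigmax_cond _ (is_clique e) (fun A => #|A|) S cS.
apply: leq_trans (leq_sub2l _ leS) _.
(* What remains is [2 * #|T| <= #|S| + size w], compared vertex by vertex: a vertex occurs at least
   twice, or once and is then counted in [S] too. *)
rewrite leq_subLR size_sum_count -sum1_card big_mkcond -big_split /=.
rewrite mulnC -sum_nat_const; apply: leq_sum => a _.
rewrite inE; have: 0 < count_mem a w by rewrite -has_count has_pred1.
by case: (count_mem a w) => [|[|m]].
Qed.

End LowerBound.

Section StrictOrder.
Variables (T : finType) (o : rel T).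
Hypotheses (oA : forall x y, ~~ (o x y && o y x)) (oT : transitive o).

Definition down x := [set y | o y x].

Lemma strict_irr x : o x x = false.
Proof. by apply/negbTE; move: (oA x x); rewrite andbb. Qed.

Lemma strict_neq x y : o x y -> x != y.
Proof. by apply: contraTneq => ->; rewrite strict_irr. Qed.

Lemma ltn_card_down x y : o x y -> #|down x| < #|down y|.
Proof.
move=> xy; apply/proper_card/properP; split.
  by apply/subsetP=> z; rewrite !inE => /oT; apply.
by exists x; rewrite inE // strict_irr.
Qed.

Lemma lower_cover x y :
  o x y -> exists2 u, (x = u \/ o x u) & hasse o u y.
Proof.
move=> xy; pose P u := ((x == u) || o x u) && o u y.
have Px: P x by rewrite /P eqxx xy.
case: (arg_maxnP (fun u => #|down u|) Px) => u /andP[xu uy] umax.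
exists u; first by case/orP: xu => [/eqP|]; auto.
rewrite /hasse uy /=; apply/existsP => -[z /andP[uz zy]].
have /umax: P z.
  by rewrite /P zy andbT; case/orP: xu => [/eqP->|/oT->]; rewrite ?uz ?orbT.
by apply/negP; rewrite -ltnNge ltn_card_down.
Qed.

(** * Rooted tree orders: predecessors form a chain *)

Section Root.
Variable r : T.
Hypothesis rP : forall x, x = r \/ o r x.
Hypothesis hT : is_tree (hasse_graph o).

Let avoid z : rel T := fun x y => [&& hasse_graph o x y, x != z & y != z].

(** Descending from [x] through lower covers ends at [r], and every vertex met is below [z], hence
    different from [z]. *)
Lemma connect_root_avoid z x : o x z -> connect (avoid z) r x.
Proof.
have [m] := ubnP #|down x|; elim: m x => // m IH x /ltnSE lem xz.
have [->|rx] := rP x; first exact: connect0.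
have [u _ ux] := lower_cover rx; have [oux _] := andP ux.
have uz := oT oux xz.
apply: connect_trans (IH u (leq_trans (ltn_card_down oux) lem) uz) _.
by apply: connect1; rewrite /avoid /hasse_graph ux !strict_neq.
Qed.

(* Two lower covers of [z] are joined through the root by a path below [z],
   which [z] closes up to a cycle. *)
Lemma lower_cover_inj z x y : hasse o x z -> hasse o y z -> x = y.
Proof.
move=> xz yz; apply/eqP; apply/negPn/negP => nxy.
have [oxz _] := andP xz; have [oyz _] := andP yz.
have avC: connect_sym (avoid z).
  by apply: sym_connect_sym => a b;
    rewrite /avoid /hasse_graph orbC [(a != z) && _]andbC.
have: connect (avoid z) x y.
  by apply: connect_trans (connect_root_avoid oyz); rewrite avC connect_root_avoid.
case/connectP => p0 /shortenP[p pp up _] ylast.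
have zp: z \notin x :: p.
  rewrite inE eq_sym (negbTE (strict_neq oxz)) /=.
  elim: p x pp {nxy xz oxz up ylast} => //= a p IH x /andP[/and3P[_ _ az] pp].
  by rewrite inE eq_sym (negbTE az) (IH a).
have [_ _ /(_ (z :: x :: p))] := hT.
case: p pp up ylast zp => [|a p] pp up ylast zp; first by rewrite ylast eqxx in nxy.
have cyc : ucycle (hasse_graph o) (z :: x :: a :: p); last by move/(_ cyc).
apply/andP; split; last by rewrite cons_uniq zp.
rewrite (cycle_path z) /= -[last a p]/(last x (a :: p)) -ylast.
rewrite {1 2}/hasse_graph xz yz orbT /=.
by apply: sub_path pp => b c /andP[].
Qed.

(** Both [x] and [y] lie weakly below the unique lower cover of [z], so induction on the down-set of
    [z] applies. *)
Lemma down_chain x y z : o x z -> o y z -> [\/ x = y, o x y | o y x].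
Proof.
have [m] := ubnP #|down z|; elim: m z => // m IH z /ltnSE lem xz yz.
have [u xu uz] := lower_cover xz; have [v yv vz] := lower_cover yz.
have E := lower_cover_inj uz vz; subst v; have [ouz _] := andP uz.
case: xu yv => [->|xu] [->|yv]; [exact: Or31|exact: Or33|exact: Or32|].
exact: IH (leq_trans (ltn_card_down ouz) lem) xu yv.
Qed.

End Root.

(** * Two linear extensions from a depth-first search favouring a chain *)

Section Forest.
Hypothesis oC : forall x y z, o x z -> o y z -> [\/ x = y, o x y | o y x].
Variable C : {set T}.
Hypothesis Cchain : forall x y, x \in C -> y \in C -> x != y -> o x y || o y x.
Hypothesis Cdown : forall x y, o x y -> y \in C -> x \in C.

(** Choice of the next vertex of the search, taken in [C] while [C] meets [A]. As [C] is closed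
    under predecessors, a minimal element of [C :&: A] is minimal in [A]. *)
Lemma minimal_vertex (A : {set T}) : A != set0 ->
  exists m, [/\ m \in A, forall x, x \in A -> ~~ o x m
            & m \notin C -> [disjoint C & A]].
Proof.
move=> A0.
have minP (B : {set T}) : B != set0 ->
    exists2 m, m \in B & forall x, x \in B -> ~~ o x m.
  case/set0Pn => x0 x0B; case: (arg_minnP (fun u => #|down u|) x0B) => m mB mmin.
  by exists m => // x xB; apply: contraL (mmin x xB) => /ltn_card_down; rewrite ltnNge.
have [CA0|] := eqVneq (C :&: A) set0.
  by have [m mA mm] := minP A A0; exists m; rewrite -setI_eq0 CA0 eqxx.
case/minP => m; rewrite inE => /andP[mC mA] mm.
exists m; split; rewrite ?mC // => x xA; apply/negP => xm.
by have:= mm x; rewrite inE (Cdown xm mC) xA xm => /(_ isT).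
Qed.

(** Pick [m] as above, and split the rest of [A] into the vertices [D] above [m] and the remainder
    [R]. No vertex of [R] is comparable to [m] or to [D], so [P] may list [m], [D], [R] and [Q] may
    list [R], [m], [D], which reverses exactly the incomparable blocks. The third clause exhibits
    the opposite orders as a word with a repeated middle letter. *)
Lemma forest_realizer (A : {set T}) : exists P Q : seq T,
  [/\ [/\ uniq P, uniq Q, P =i A & Q =i A],
      {in A &, forall x y, o x y -> restr x y P = [:: x; y] /\ restr x y Q = [:: x; y]},
      {in A &, forall x y, x != y -> ~~ o x y -> ~~ o y x ->
        restr x y P ++ restr x y Q \in [:: [:: x; y; y; x]; [:: y; x; x; y]]}
    & {in A &, forall c x, c \in C -> x \notin C -> ~~ o c x ->
        restr c x Q = [:: x; c]}].
Proof.
have [n] := ubnP #|A|; elim: n A => // n IH A /ltnSE lem.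
have [->|A0] := eqVneq A set0.
  by exists [::], [::]; split; first split=> //;
    move=> x; rewrite ?inE // => y; rewrite inE.
have [m [mA mmin mC]] := minimal_vertex A0.
pose D := [set x in A | o m x]; pose R := [set x in A | (x != m) && ~~ o m x].
have mD : m \notin D by rewrite inE strict_irr andbF.
have mR : m \notin R by rewrite inE eqxx andbF.
have ltA (B : {set T}) : {subset B <= A} -> m \notin B -> #|B| < n.
  move=> BA mB; apply: leq_trans lem; apply: proper_card; apply/properP.
  by split; [exact/subsetP | exists m].
have [|P1 [Q1 [[uP1 uQ1 P1D Q1D] lt1 inc1 C1]]] := IH D.
  by apply: ltA => // x; rewrite inE => /andP[].
have [|P2 [Q2 [[uP2 uQ2 P2R Q2R] lt2 inc2 C2]]] := IH R.
  by apply: ltA => // x; rewrite inE => /andP[].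
have DA x : x \in D -> x \in A by rewrite inE => /andP[].
have RA x : x \in R -> x \in A by rewrite inE => /andP[].
have DR x : x \in D -> x \notin R.
  by rewrite !inE => /andP[-> ->]; rewrite !andbF.
have RD x : x \in R -> x \notin D by apply: contraL; apply: DR.
have mDlt x : x \in D -> o m x by rewrite inE => /andP[].
have neqR x : x \in R -> x != m by rewrite inE => /and3P[].
have mRinc x : x \in R -> ~~ o m x /\ ~~ o x m.
  by rewrite inE => /and3P[/mmin ? _ ?].
have DRinc x y : x \in D -> y \in R -> ~~ o x y /\ ~~ o y x.
  move=> /mDlt mx yR; have [nmy nym] := mRinc _ yR; split.
    by apply: contra nmy; apply: oT.
  (* Here [y] and [m] are both predecessors of [x], hence comparable. *)
  apply/negP => yx; case: (oC yx mx) => [E|ym|my].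
  - by rewrite E (negbTE mR) in yR.
  - by rewrite ym in nym.
  - by rewrite my in nmy.
(* If [m] is in [C], the rest of the chain in [A] is comparable to [m]; otherwise [C] misses [A]. *)
have RC x : x \in R -> x \notin C.
  move=> xR; have [nmx nxm] := mRinc _ xR.
  have [mC'|/mC dCA] := boolP (m \in C).
    apply/negP => xC; have:= Cchain mC' xC.
    by rewrite eq_sym neqR // (negbTE nmx) (negbTE nxm) => /(_ isT).
  by apply/negP => xC; move/pred0P/(_ x): dCA; rewrite /= xC RA.
have splitA x : x \in A -> [\/ x = m, [/\ x \in D, (x \in R) = false & (x == m) = false]
                                | [/\ x \in R, (x \in D) = false & (x == m) = false]].
  move=> xA; have [->|nxm] := eqVneq x m; first exact: Or31.
  have [xD|xD] := boolP (x \in D); first by apply: Or32; rewrite (negbTE (DR _ xD)).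
  by apply: Or33; split=> //; move: xD; rewrite !inE xA nxm.
have restrE x y : restr x y (m :: P1 ++ P2) =
    restr x y [:: m] ++ restr x y P1 ++ restr x y P2 /\
  restr x y (Q2 ++ m :: Q1) = restr x y Q2 ++ restr x y [:: m] ++ restr x y Q1.
  by rewrite -!restr_cat.
have rm x y : restr x y [:: m] =
    if x == m then if y == m then restr x y [:: m] else [:: x]
    else if y == m then [:: y] else [::].
  by apply: (@restr_mem _ (pred1 m)) => // z; rewrite mem_seq1.
have rP1 x y := restr_mem x y uP1 P1D; have rP2 x y := restr_mem x y uP2 P2R.
have rQ1 x y := restr_mem x y uQ1 Q1D; have rQ2 x y := restr_mem x y uQ2 Q2R.
clearbody D R; have mDf := negbTE mD; have mRf := negbTE mR.
exists (m :: P1 ++ P2), (Q2 ++ m :: Q1); split.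
- have mems x : (x \in A) = [|| x == m, x \in D | x \in R].
    apply/idP/idP => [/splitA[->|[-> _ _]|[-> _ _]]|]; rewrite ?eqxx ?orbT //.
    by case/or3P => [/eqP->|/DA|/RA].
  split.
  + rewrite /= cat_uniq uP1 uP2 mem_cat P1D P2R mDf mRf /= andbT.
    by apply/hasPn => x; rewrite P2R /= P1D => /RD.
  + rewrite cat_uniq uQ2 /= uQ1 Q1D mDf Q2R (negbTE mR) /= andbT.
    by apply/hasPn => x; rewrite Q1D /= Q2R => /DR.
  + by move=> x; rewrite mems inE mem_cat P1D P2R.
  + by move=> x; rewrite mems mem_cat inE Q1D Q2R orbC orbA.
- move=> x y xA yA xy; have [-> ->] := restrE x y.
  rewrite rm rP1 rP2 rQ1 rQ2.
  (* Nine cases, by the blocks [m], [D], [R] of the two letters; [//=] closes those decided by the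
     order of the blocks. *)
  case: (splitA x xA) (splitA y yA) => [?|[xD xR xm]|[xR xD xm]]
    [?|[yD yR ym]|[yR yD ym]]; subst;
    rewrite ?eqxx ?mDf ?mRf ?xD ?xR ?xm ?yD ?yR ?ym ?cats0 //=.
  + by rewrite strict_irr in xy.
  + by case: (mRinc y yR) => /negP.
  + by rewrite (negbTE (mmin x xA)) in xy.
  + exact: lt1.
  + by case: (DRinc x y xD yR) => /negP.
  + by case: (mRinc x xR) => _ /negP.
  + by case: (DRinc y x yD xR) => _ /negP.
  + exact: lt2.
- move=> x y xA yA nxy xy yx; have [-> ->] := restrE x y.
  rewrite rm rP1 rP2 rQ1 rQ2.
  case: (splitA x xA) (splitA y yA) => [?|[xD xR xm]|[xR xD xm]]
    [?|[yD yR ym]|[yR yD ym]]; subst;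
    rewrite ?eqxx ?mDf ?mRf ?xD ?xR ?xm ?yD ?yR ?ym ?cats0 //=.
  + by rewrite eqxx in nxy.
  + by rewrite mDlt in xy.
  + by rewrite mem_head.
  + by rewrite mDlt in yx.
  + exact: inc1.
  + by rewrite mem_head.
  + by rewrite inE mem_head orbT.
  + by rewrite inE mem_head orbT.
  + exact: inc2.
(* The letter [c] is never in [R], the first block of [Q]. So [x] comes first unless [c = m] and [x]
   is in [D], which [ncx] excludes, or both lie in [D], where induction applies. *)
- move=> c x cA xA cC xC ncx; have [_ ->] := restrE c x.
  rewrite rm rQ1 rQ2.
  case: (splitA c cA) (splitA x xA) => [?|[cD cR cm]|[cR cD cm]]
    [?|[xD xR xm]|[xR xD xm]]; subst;
    rewrite ?eqxx ?mDf ?mRf ?cD ?cR ?cm ?xD ?xR ?xm ?cats0 //=.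
  + by rewrite cC in xC.
  + by rewrite mDlt in ncx.
  + exact: C1.
  + by rewrite (negbTE (RC c cR)) in cC.
  + by rewrite (negbTE (RC c cR)) in cC.
  + exact: C2.
Qed.

End Forest.

(** * A word of length [2n - k] for a forest order *)

Variable e : rel T.
Hypothesis eE : forall x y, e x y = o x y || o y x.
Hypothesis oC : forall x y z, o x z -> o y z -> [\/ x = y, o x y | o y x].

(** Otherwise [x |: C] would be a larger clique: an element of [C] above [y] is above [x] by
    transitivity, and one below [y] is comparable to [x] because predecessors of [y] form a
    chain. *)
Lemma max_clique_down (C : {set T}) : is_clique e C -> #|C| = clique_number e ->
  forall x y, o x y -> y \in C -> x \in C.
Proof.
move=> cC cardC x y xy yC; apply/negPn/negP => xC.
have cl a b : a \in C -> b \in C -> a != b -> e a b.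
  move=> aC bC nab; move: cC.
  by move=> /forall_inP/(_ a aC)/forall_inP/(_ b bC)/implyP; apply.
have xadj a : a \in C -> e x a.
  move=> aC; rewrite eE; have [->|/(cl _ _ aC yC)] := eqVneq a y; first by rewrite xy.
  rewrite eE => /orP[ay|ya]; last by rewrite (oT xy ya).
  by case: (oC xy ay) aC xC => [->->|->|->]; rewrite ?orbT.
have: is_clique e (x |: C).
  apply/forall_inP => a; rewrite !inE => /orP[/eqP->|aC]; apply/forall_inP => b;
    rewrite !inE => /orP[/eqP->|bC]; apply/implyP => nab.
  - by rewrite eqxx in nab.
  - exact: xadj.
  - by rewrite eE orbC -eE xadj.
  - exact: cl.
move/(@leq_bigmax_cond _ (is_clique e) (fun A => #|A|)).
by rewrite cardsU1 xC cardC ltnn.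
Qed.

Lemma forest_word : exists2 w, word_representant e w &
  size w = 2 * #|T| - clique_number e.
Proof.
have [|C cC cardC] := @eq_bigmax_cond _ (is_clique e) (fun A => #|A|).
  by apply/card_gt0P; exists set0; apply/forallP => x; rewrite inE.
rewrite -/(clique_number e) in cardC.
have Cdown := max_clique_down cC (esym cardC).
have Cchain x y : x \in C -> y \in C -> x != y -> o x y || o y x.
  rewrite -eE => xC yC nxy.
  by move: cC => /forall_inP/(_ x xC)/forall_inP/(_ y yC)/implyP; apply.
have [P [Q [[uP uQ PT QT] lt inc CQ]]] := forest_realizer oC Cchain Cdown setT.
pose w := [seq x <- P | x \notin C] ++ Q.
have rw x y : restr x y w = [seq z <- restr x y P | z \notin C] ++ restr x y Q.
  rewrite restr_cat /restr -!filter_predI; congr (_ ++ _).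
  by apply: eq_filter => z /=; rewrite andbC.
exists w; last first.
  have szT s : uniq s -> s =i [set: T] -> size s = #|T|.
    by move=> us sT; rewrite -(card_uniqP us) -cardsT; apply: eq_card.
  rewrite size_cat (szT Q) // cardC mul2n -addnn -addnBAC ?max_card //; congr (_ + _).
  have uf : uniq [seq x <- P | x \notin C] by rewrite filter_uniq.
  rewrite -(card_uniqP uf) -(cardsC C) addKn; apply: eq_card => x.
  by rewrite mem_filter PT !inE andbT.
split=> [x|]; first by rewrite mem_cat QT inE orbT.
have adj x y : o x y -> alternate w x y.
  move=> xy; have [Pxy Qxy] := lt x y (in_setT _) (in_setT _) xy.
  apply/(alternate_restr (rw x y)); rewrite Pxy Qxy /=.
  (* Erasing [C] from the first half of [xyxy] leaves [xy], [yxy] or [xyxy]; the third case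
     contradicts [Cdown]. *)
  have [xC|xC] := boolP (x \in C); have [yC|yC] := boolP (y \in C).
  - by exists 2; left.
  - by exists 3; right.
  - by rewrite (Cdown _ _ xy yC) in xC.
  - by exists 4; left.
have nadjC c x : c \in C -> x \notin C -> ~~ o c x -> ~~ o x c -> c != x ->
    ~ alternate w c x.
  move=> cC' xC ncx nxc neq.
  have Ec := CQ c x (in_setT _) (in_setT _) cC' xC ncx.
  have := inc c x (in_setT _) (in_setT _) neq ncx nxc.
  rewrite Ec => H; apply: (@not_alternate _ _ _ _ [::] [:: c] x neq).
  have szP : size (restr c x P) = 2.
    move: H; rewrite !inE => /orP[]/eqP/(congr1 size);
      by rewrite size_cat /= addn2 => -[].
  rewrite rw Ec; case: (restr c x P) szP H => [|a [|b []]] //= _.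
  rewrite !inE !eqseq_cons.
  case/orP => [/and3P[/eqP-> /eqP-> _]|]; first by rewrite cC' xC.
  by rewrite !eqxx eq_sym (negbTE neq) !andbF.
move=> x y nxy; rewrite eE; split=> [/orP[/adj //|/adj/alternateC //]|].
apply: contraPT; rewrite negb_or => /andP[xy yx].
have [xC|xC] := boolP (x \in C); have [yC|yC] := boolP (y \in C).
- by move: (Cchain x y xC yC nxy); rewrite (negbTE xy) (negbTE yx).
- exact: nadjC.
- by move/alternateC; apply: nadjC; rewrite // eq_sym.
(* With both letters outside [C] nothing is erased, and the repeated middle letter of [xyyx] or
   [yxxy] prevents alternation. *)
have EP : [seq z <- restr x y P | z \notin C] = restr x y P.
  by apply/all_filterP/allP => z; rewrite mem_filter => /andP[/orP[]/eqP->].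
have := inc x y (in_setT _) (in_setT _) nxy xy yx; rewrite -{1}EP -rw !inE.
case/orP => /eqP E; first exact: (@not_alternate _ _ _ _ [:: x] [:: x] y nxy).
exact: (@not_alternate _ _ _ _ [:: y] [:: y] x nxy).
Qed.

End StrictOrder.

(** * Reversal of the orientation and conclusion *)

Lemma hasse_graph_rev (T : finType) (o : rel T) :
  hasse_graph (fun x y => o y x) =2 hasse_graph o.
Proof.
move=> x y; rewrite /hasse_graph /hasse orbC.
by congr ((_ && ~~ _) || (_ && ~~ _)); apply: eq_existsb => z; rewrite andbC.
Qed.

Lemma is_tree_eq (T : finType) (h h' : rel T) : h =2 h' -> is_tree h -> is_tree h'.
Proof.
move=> hh' [T0 hc hu]; split=> // [x y|c]; first by rewrite -(eq_connect hh').
by case/andP => hc' uc; apply: hu; rewrite /ucycle (eq_cycle hh') hc'.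
Qed.

Lemma source_arborescence_word (T : finType) (e o : rel T) (r : T) :
  treelike_orientation e o -> is_root e r -> is_source o r ->
  exists2 w, word_representant e w & size w = 2 * #|T| - clique_number e.
Proof.
case=> [[[eE oA] oT] hT] rP rS.
have orP x : x = r \/ o r x.
  by case: (rP x); [left | rewrite eE (negbTE (rS x)) orbF; right].
by apply: (forest_word oA oT eE) => x y z; apply: (down_chain oA oT orP hT).
Qed.

Theorem theorem8 (T : finType) (e : rel T) (n k : nat)
  (he : simple_graph e) (harb : arborescence e)
  (hn : #|T| = n) (hk : clique_number e = k) :
  is_ell e (2 * n - k).
Proof.
rewrite -hn -hk; split; last exact: word_representant_size.
case: harb => _ [o [r [oP rP [rS|rS]]]]; first exact: source_arborescence_word oP rP rS.
(* A sink is a source of the reversed orientation, which has the same undirected Hasse diagram. *)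
apply: (@source_arborescence_word _ e (fun x y => o y x) r) => //.
case: oP => [[[eE oA] oT] hT]; split; last first.
  by apply: is_tree_eq hT => x y; rewrite hasse_graph_rev.
split; last by move=> y x z xy yz; apply: oT yz xy.
by split=> x y; [rewrite eE orbC | rewrite andbC].
Qed.
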